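(* Let $M$ be a mixed graph of order $n$ and let $uv$ be an edge of the underlying graph $M_U$ which is a cut-edge (bridge) of $M_U$. If $uv$ is an undirected edge of $M$ and $M_1$ is obtained from $M$ by replacing it with a single arc $(u,v)$ or $(v,u)$, or if $uv$ is an arc of $M$ and $M_1$ is obtained from $M$ by replacing that arc with the undirected edge $uv$, then $R_H(M)$ and $R_H(M_1)$ have the same spectrum, and hence $\mathcal{E}_{R_H}(M)=\mathcal{E}_{R_H}(M_1)$.
   Context: A mixed graph $M$ is obtained from a simple graph $M_U$ (underlying graph) by orienting some of its edges; degrees $d_k$ are taken in $M_U$. The Hermitian-Randić matrix $R_H(M)$ has $(k,l)$ entry $\frac{1}{\sqrt{d_kd_l}}$ if $v_kv_l$ is an undirected edge, $\frac{\mathrm{i}}{\sqrt{d_kd_l}}$ if $(v_k,v_l)$ is an arc, $\frac{-\mathrm{i}}{\sqrt{d_kd_l}}$ if $(v_l,v_k)$ is an arc, and $0$ otherwise. The Hermitian-Randić energy $\mathcal{E}_{R_H}(M)$ is the sum of the absolute values of the eigenvalues of $R_H(M)$. *)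

(* Defs.v *)
From HB Require Import structures.
From mathcomp Require Import all_boot all_order all_algebra.

Set Implicit Arguments.
Unset Strict Implicit.
Unset Printing Implicit Defensive.

Import Order.TTheory GRing.Theory Num.Theory.
Local Open Scope ring_scope.

Record simple_graph (n : nat) := SimpleGraph {
  edge :> rel 'I_n;
  edge_sym : symmetric edge;
  edge_irr : irreflexive edge
}.

Definition deg n (G : simple_graph n) (k : 'I_n) : nat := #|[set l | G k l]|.

Definition same_edge n (u v x y : 'I_n) : bool :=
  ((x == u) && (y == v)) || ((x == v) && (y == u)).

Definition del_edge n (e : rel 'I_n) (u v : 'I_n) : rel 'I_n :=
  [rel x y | e x y && ~~ same_edge u v x y].

(* [n_comp e predT] is the number of connected components. *)
Definition cut_edge n (G : simple_graph n) (u v : 'I_n) : bool :=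
  G u v && (n_comp G predT < n_comp (del_edge G u v) predT)%N.

(* An edge of [underlying] is undirected unless [arc] orients it, in exactly
   one of its two directions. *)
Record mixed_graph (n : nat) := MixedGraph {
  underlying : simple_graph n;
  arc : rel 'I_n;
  arc_edge : forall x y, arc x y -> underlying x y;
  arc_asym : forall x y, arc x y -> ~~ arc y x
}.

Definition undirected n (M : mixed_graph n) (x y : 'I_n) : bool :=
  [&& underlying M x y, ~~ arc M x y & ~~ arc M y x].

Definition agree_off n (M M1 : mixed_graph n) (u v : 'I_n) : Prop :=
  underlying M1 =2 underlying M /\
  (forall x y, ~~ same_edge u v x y -> arc M1 x y = arc M x y).

Definition edge_to_arc n (M M1 : mixed_graph n) (u v : 'I_n) : Prop :=
  [/\ undirected M u v, arc M1 u v & agree_off M M1 u v].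

Definition arc_to_edge n (M M1 : mixed_graph n) (u v : 'I_n) : Prop :=
  [/\ arc M u v, undirected M1 u v & agree_off M M1 u v].

(* [C] stands for the complex numbers; any numClosedFieldType is allowed. *)
Definition randic_mx (C : numClosedFieldType) n (M : mixed_graph n) : 'M[C]_n :=
  \matrix_(k, l)
    let w : C := sqrtC (deg (underlying M) k * deg (underlying M) l)%N%:R in
    if undirected M k l then 1 / w
    else if arc M k l then 'i / w
    else if arc M l k then - 'i / w
    else 0.

(* The eigenvalues with algebraic multiplicity; the order of the sequence is
   arbitrary, so spectra are to be compared with [perm_eq]. *)
Definition spectrum (C : numClosedFieldType) n (A : 'M[C]_n) : seq C :=
  sval (closed_field_poly_normal (char_poly A)).

Lemma char_poly_spectrum (C : numClosedFieldType) n (A : 'M[C]_n) :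
  char_poly A = \prod_(x <- spectrum A) ('X - x%:P).
Proof.
rewrite /spectrum; case: closed_field_poly_normal => s /= {1}->.
by rewrite (monicP (char_poly_monic A)) scale1r.
Qed.

Definition randic_energy (C : numClosedFieldType) n (M : mixed_graph n) : C :=
  \sum_(x <- spectrum (randic_mx C M)) `|x|.

(* Main.v *)
Require Import Defs.
From HB Require Import structures.
From mathcomp Require Import all_boot all_order all_algebra.

Set Implicit Arguments.
Unset Strict Implicit.
Unset Printing Implicit Defensive.

Import GRing.Theory Num.Theory.
Local Open Scope ring_scope.

(** Deleting the bridge uv leaves u and v in different components. Let D be the
    diagonal matrix with entry i on the component of u and 1 elsewhere. Every
    other edge of the graph joins vertices with equal entries of D, so
    conjugation by D changes R_H(M) only in the entries (u,v) and (v,u), which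
    it multiplies by i and -i: this is exactly the passage from the undirected
    edge uv to the arc (u,v). *)

(** Writing [D] for the diagonal matrix of [d], the hypothesis reads [D A = B D]. Over a domain [D]
    need not be invertible, so the relation is lifted to [D (X - A) = (X - B) D] and the nonzero
    factor [\det D] is cancelled after taking determinants. *)
Lemma char_poly_diag_similar (R : idomainType) n (A B : 'M[R]_n)
    (d : 'I_n -> R) :
  (forall k, d k != 0) -> (forall k l, d k * A k l = B k l * d l) ->
  char_poly A = char_poly B.
Proof.
move=> d_neq0 dAB.
pose D : 'M[{poly R}]_n := diag_mx (\row_k (d k)%:P).
have DAB : D *m char_poly_mx A = char_poly_mx B *m D.
  rewrite /D mul_diag_mx mul_mx_diag; apply/matrixP=> k l.
  rewrite !mxE mulrBr mulrBl -!polyCM dAB; congr (_ - _).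
  by case: eqP => [->|_]; [rewrite mulrC | rewrite !mulr0n mulr0 mul0r].
have detD_neq0 : \det D != 0.
  rewrite det_diag; apply/prodf_neq0=> k _.
  by rewrite mxE polyC_eq0.
apply: (mulfI detD_neq0).
by rewrite -det_mulmx DAB det_mulmx mulrC.
Qed.

Lemma same_edgeC n (u v x y : 'I_n) : same_edge u v y x = same_edge u v x y.
Proof. by rewrite /same_edge orbC; congr orb; apply: andbC. Qed.

Lemma same_edge_swap n (u v x y : 'I_n) : same_edge v u x y = same_edge u v x y.
Proof. exact: orbC. Qed.

Lemma del_edge_sym n (G : simple_graph n) u v : symmetric (del_edge G u v).
Proof. by move=> x y; rewrite /del_edge /= edge_sym same_edgeC. Qed.

Lemma eq_del_edge n (e e' : rel 'I_n) u v :
  e =2 e' -> del_edge e u v =2 del_edge e' u v.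
Proof. by move=> ee' x y; rewrite /del_edge /= ee'. Qed.

(** If a path from [u] to [v] survived the deletion, it could replace the edge in every walk of [G];
    both graphs would then have the same components, and their number could not increase. *)
Lemma cut_edge_disconnected n (G : simple_graph n) u v :
  cut_edge G u v -> ~~ connect (del_edge G u v) u v.
Proof.
case/andP=> Guv; apply: contraTN => cuv.
rewrite -leqNgt (@eq_n_comp _ (del_edge G u v) G) // => x y.
apply/idP/idP; apply: connect_sub => {}x {}y.
  by case/andP=> Gxy _; apply: connect1.
move=> Gxy; have [|nxy] := boolP (same_edge u v x y); last first.
  by apply: connect1; rewrite /del_edge /= Gxy.
case/orP=> /andP[/eqP-> /eqP->] //.
by rewrite (sym_connect_sym (@del_edge_sym n G u v)).
Qed.

Lemma agree_off_sym n (M M1 : mixed_graph n) u v :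
  agree_off M M1 u v -> agree_off M1 M u v.
Proof.
case=> eG eA; split=> [x y|x y nxy]; first by rewrite eG.
by rewrite eA.
Qed.

Lemma agree_off_randic (C : numClosedFieldType) n (M M1 : mixed_graph n)
    u v x y :
  agree_off M M1 u v -> ~~ same_edge u v x y ->
  randic_mx C M1 x y = randic_mx C M x y.
Proof.
case=> eG eA nxy; have nyx : ~~ same_edge u v y x by rewrite same_edgeC.
have eD k : deg (underlying M1) k = deg (underlying M) k.
  by apply: eq_card => l; rewrite !inE eG.
by rewrite !mxE /undirected !eD eG !eA.
Qed.

Lemma randic_mx_nonedge (C : numClosedFieldType) n (M : mixed_graph n) x y :
  ~~ underlying M x y -> randic_mx C M x y = 0.
Proof.
move=> nxy; have nyx : ~~ underlying M y x by rewrite edge_sym.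
by rewrite mxE /undirected (negPf nxy) (negPf (contra (@arc_edge _ M x y) nxy))
  (negPf (contra (@arc_edge _ M y x) nyx)).
Qed.

(** The bridge property enters as the absence of a path, a form that carries over when [u] and [v],
    or [M] and [M1], are exchanged. *)
Lemma char_poly_edge_to_arc (C : numClosedFieldType) n (M M1 : mixed_graph n)
    u v :
  ~~ connect (del_edge (underlying M) u v) u v -> edge_to_arc M M1 u v ->
  char_poly (randic_mx C M) = char_poly (randic_mx C M1).
Proof.
set e := del_edge _ u v => ncuv [uM aM1 agr]; have [eG _] := agr.
have e_sym : connect_sym e by apply/sym_connect_sym/del_edge_sym.
have eD k : deg (underlying M1) k = deg (underlying M) k.
  by apply: eq_card => l; rewrite !inE eG.
have [Guv /negPf nauv /negPf navu] := and3P uM.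
have /negPf na1vu := arc_asym aM1.
pose d k : C := if connect e u k then 'i else 1.
have du : d u = 'i by rewrite /d connect0.
have dv : d v = 1 by rewrite /d (negPf ncuv).
(* With [D] the diagonal matrix of [d], the relation to check is [D^-1 R_H(M1) = R_H(M) D^-1]. *)
symmetry; apply: (@char_poly_diag_similar _ _ _ _ (fun k => (d k)^-1)).
  by move=> k; rewrite invr_eq0 /d; case: ifP; rewrite ?neq0Ci ?oner_eq0.
move=> k l; have [|nkl] := boolP (same_edge u v k l).
  (* On the bridge, with weight [w]: the entry [(u,v)] needs ['i^-1 * ('i / w) = 1 / w], and the
     entry [(v,u)] needs [- 'i / w = (1 / w) * 'i^-1]. *)
  case/orP=> /andP[/eqP-> /eqP->]; rewrite du dv invr1 ?mulr1 ?mul1r !mxE.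
    rewrite /undirected !eD eG Guv aM1 nauv navu /=.
    by rewrite !mulrA mulVf ?neq0Ci.
  rewrite /undirected !eD eG edge_sym Guv aM1 na1vu nauv navu /=.
  by rewrite invCi mulrC div1r.
rewrite (agree_off_randic C agr nkl).
have [Gkl|nG] := boolP (underlying M k l); last first.
  by rewrite randic_mx_nonedge // mulr0 mul0r.
(* The edge [kl] survives the deletion, so its ends share a component of [e]. *)
suff -> : d k = d l by rewrite mulrC.
have ckl : connect e k l by apply: connect1; rewrite /e /del_edge /= Gkl.
by rewrite /d !(e_sym u) (same_connect e_sym ckl).
Qed.

Theorem theorem4p1 (C : numClosedFieldType) (n : nat)
    (M M1 : mixed_graph n) (u v : 'I_n)
    (huv : cut_edge (underlying M) u v)
    (hM1 : edge_to_arc M M1 u v \/ edge_to_arc M M1 v u \/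
           arc_to_edge M M1 u v \/ arc_to_edge M M1 v u) :
  perm_eq (spectrum (randic_mx C M)) (spectrum (randic_mx C M1)) /\
  randic_energy C M = randic_energy C M1.
Proof.
have ncuv := cut_edge_disconnected huv.
have ncvu : ~~ connect (del_edge (underlying M) v u) v u.
  rewrite (sym_connect_sym (@del_edge_sym n _ v u)).
  rewrite (eq_connect (e' := del_edge (underlying M) u v)) // => x y.
  by rewrite /del_edge /= same_edge_swap.
(* Removing an orientation is adding one with [M] and [M1] exchanged; the two underlying graphs
   agree, so the absence of a path passes to [M1]. *)
have rev x y : ~~ connect (del_edge (underlying M) x y) x y ->
    arc_to_edge M M1 x y ->
    char_poly (randic_mx C M) = char_poly (randic_mx C M1).
  move=> nc [aM uM1 agr]; symmetry; apply: (@char_poly_edge_to_arc _ _ _ _ x y).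
    by rewrite (eq_connect (eq_del_edge _ _ (proj1 agr))).
  by split=> //; apply: agree_off_sym.
have eqchar : char_poly (randic_mx C M) = char_poly (randic_mx C M1).
  case: hM1 => [h|[h|[h|h]]]; first exact: char_poly_edge_to_arc h.
  - exact: char_poly_edge_to_arc h.
  - exact: rev h.
  - exact: rev h.
(* The chosen list of roots depends only on the characteristic polynomial, so the two spectra are
   equal even as sequences. *)
by rewrite /randic_energy /spectrum eqchar.
Qed.
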